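(* Let $f:\mathbb{R}^n\to\mathbb{R}$ be a strictly convex self-concordant function with constant $M>0$ and let $\sigma\in(0,1]$. Let $\lambda(x)=\left[\nabla f(x)^\top\nabla^2 f(x)^{-1}\nabla f(x)\right]^{1/2}$ be the Newton decrement. Assume that the sequence $(x_k)_{k\in\mathbb{N}}$ is generated by the Adaptive Multilevel Newton method with the self-concordant acceptance condition and unit step sizes (defined in the context). Then, for any $k\in\mathbb{N}$, if $M\lambda(x_k)<1$, $$\lambda(x_{k+1})\le\frac{M\lambda(x_k)^2}{\sigma\,(1-M\lambda(x_k))^2}.$$
   Context: Self-concordance with constant $M>0$ means that $f$ is three times continuously differentiable and $|D^3 f(x)[u,u,u]|\le 2M\left[u^\top\nabla^2 f(x)u\right]^{3/2}$ for all $x,u\in\mathbb{R}^n$. Standing assumptions: $f$ is strictly convex and bounded below so that its minimizer exists; its Hessian is positive definite everywhere, so that the inverses below exist. There are $m>1$ levels with dimensions $n_1<n_2<\cdots<n_{m-1}<n_m=n$. For each coarse level $1\le i\le m-1$ and each $k\in\mathbb{N}$, $R_{i,k}\in\mathbb{R}^{n_i\times n}$ has rank $n_i$ and $P_{i,k}:=R_{i,k}^\top$; at the fine level $R_{m,k}=P_{m,k}:=I_n$. For $x\in\mathbb{R}^n$ define $$g_{i,k}(x):=\left[(R_{i,k}\nabla f(x))^\top\left(R_{i,k}\nabla^2 f(x)P_{i,k}\right)^{-1}(R_{i,k}\nabla f(x))\right]^{1/2}.$$ Adaptive Multilevel Newton method with self-concordant acceptance condition (unit step sizes $\alpha_k\equiv1$).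 Given $x_0\in\mathbb{R}^n$ and $\sigma\in(0,1]$, at each iteration $k=0,1,2,\ldots$ define for each $1\le i\le m$ the trial point $$x_{k+1}^{(i)}:=x_k-P_{i,k}\left(R_{i,k}\nabla^2 f(x_k)P_{i,k}\right)^{-1}R_{i,k}\nabla f(x_k),$$ (so $x_{k+1}^{(m)}=x_k-\nabla^2 f(x_k)^{-1}\nabla f(x_k)$ is the pure Newton step). Let $i^*$ be the smallest $i\in\{1,\ldots,m\}$ such that $$\|R_{i,k}\nabla f(x_k)\|\ge\sigma\|\nabla f(x_k)\|\quad\text{and}\quad g_{i,k}(x_{k+1}^{(i)})\ge\sigma\,\lambda(x_{k+1}^{(i)}),$$ (the index $i=m$ always qualifies), and set $x_{k+1}:=x_{k+1}^{(i^* )}$. Here $\|\cdot\|$ is the Euclidean norm. *)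

(* Defs.v *)
From HB Require Import structures.
From mathcomp Require Import all_boot all_order all_algebra.
From mathcomp Require Import all_classical all_reals all_analysis.

Set Implicit Arguments.
Unset Strict Implicit.
Unset Printing Implicit Defensive.

Import Order.TTheory GRing.Theory Num.Theory.
Import numFieldNormedType.Exports.

Local Open Scope classical_set_scope.
Local Open Scope ring_scope.

Section Calculus.
Variables (R : realType) (n : nat).
Implicit Types (f : 'cV[R]_n -> R) (x u v w : 'cV[R]_n) (i j l : 'I_n).

(* Points of R^n are column vectors; the topology of 'cV[R]_n is the usual one,
   although its library norm is the sup norm; enorm below is the Euclidean
   norm. *)

Definition partial i f : 'cV[R]_n -> R := fun x => 'D_(delta_mx i 0) f x.

(* All partial derivatives of order at most k exist and are continuous. *)
Fixpoint continuously_differentiable (k : nat) f : Prop :=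
  if k is k'.+1 then
    continuous f /\
    forall i, (forall x, derivable f x (delta_mx i 0)) /\
              continuously_differentiable k' (partial i f)
  else continuous f.

Definition gradient f x : 'cV[R]_n := \col_i partial i f x.

Definition hessian f x : 'M[R]_n := \matrix_(i, j) partial i (partial j f) x.

Definition third_derivative f x u v w : R :=
  \sum_i \sum_j \sum_l
    partial i (partial j (partial l f)) x * u i 0 * v j 0 * w l 0.

Definition quad_form p (A : 'M[R]_p) (u : 'cV[R]_p) : R := (u^T *m A *m u) 0 0.

Definition posdefmx (A : 'M[R]_n) : Prop :=
  A^T = A /\ forall u, u != 0 -> 0 < quad_form A u.

Definition strictly_convex f : Prop :=
  forall x y (t : R), x != y -> 0 < t < 1 ->
    f (t *: x + (1 - t) *: y) < t * f x + (1 - t) * f y.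

Definition bounded_below f : Prop := exists c : R, forall x, c <= f x.

Definition self_concordant (M : R) f : Prop :=
  continuously_differentiable 3 f /\
  forall x u, `|third_derivative f x u u u|
                <= 2 * M * quad_form (hessian f x) u `^ (3 / 2).

Definition newton_decrement f x : R :=
  Num.sqrt (quad_form (invmx (hessian f x)) (gradient f x)).

End Calculus.

Definition enorm (R : realType) (p : nat) (v : 'cV[R]_p) : R :=
  Num.sqrt (\sum_i v i 0 ^+ 2).

Section Multilevel.
Variables (R : realType) (n : nat) (f : 'cV[R]_n -> R).

(* r is a restriction operator; its prolongation operator is r^T. *)

Definition coarse_hessian p (r : 'M[R]_(p, n)) (x : 'cV[R]_n) : 'M[R]_p :=
  r *m hessian f x *m r^T.

Definition coarse_decrement p (r : 'M[R]_(p, n)) (x : 'cV[R]_n) : R :=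
  Num.sqrt (quad_form (invmx (coarse_hessian r x)) (r *m gradient f x)).

Definition trial_point p (r : 'M[R]_(p, n)) (x : 'cV[R]_n) : 'cV[R]_n :=
  x - r^T *m invmx (coarse_hessian r x) *m (r *m gradient f x).

Definition acceptable (sigma : R) p (r : 'M[R]_(p, n)) (x : 'cV[R]_n) : bool :=
  (sigma * enorm (gradient f x) <= enorm (r *m gradient f x)) &&
  (sigma * newton_decrement f (trial_point r x)
     <= coarse_decrement r (trial_point r x)).

End Multilevel.

(* Levels are numbered 1, ..., m and level i has dimension d i, the fine
   dimension n being d m; values at other indices are never used. *)

Definition level_dimensions (m : nat) (d : nat -> nat) : Prop :=
  [/\ (1 < m)%N, (0 < d 1)%N &
      forall i, (1 <= i < m)%N -> (d i < d i.+1)%N].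

Definition restriction_operators (R : realType) (m : nat) (d : nat -> nat)
    (r : forall i k : nat, 'M[R]_(d i, d m)) : Prop :=
  (forall i k, (1 <= i < m)%N -> \rank (r i k) = d i) /\
  (forall k, r m k = 1%:M).

Definition adaptive_multilevel_newton (R : realType) (m : nat) (d : nat -> nat)
    (r : forall i k : nat, 'M[R]_(d i, d m)) (f : 'cV[R]_(d m) -> R)
    (sigma : R) (x : nat -> 'cV[R]_(d m)) : Prop :=
  forall k, exists istar : nat,
    [/\ (1 <= istar <= m)%N,
        acceptable f sigma (r istar k) (x k),
        forall i, (1 <= i < istar)%N -> ~~ acceptable f sigma (r i k) (x k) &
        x k.+1 = trial_point f (r istar k) (x k)].

(* Main.v *)
(* Let h be the coarse step, mu its length in the local norm |u|_x = sqrt(u^T H(x) u), and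
   w = R^T z a coarse direction. Cauchy-Schwarz gives mu <= lambda(x_k). A symmetric trilinear form
   is bounded by its diagonal values, so self-concordance upgrades to
   |D^3 f(x)[w,u,u]| <= 2 M |w|_x |u|_x^2. Along the segment x_k + t h this yields the differential
   inequalities
     |h|_t <= mu / (1 - M mu t),   (1 - M mu t) |w|_0 <= |w|_t <= |w|_0 / (1 - M mu t),
   and integrating twice the bound on D^3 f[w,h,h],
     w^T (grad f(x_k + h) - grad f(x_k) - H(x_k) h) <= |w|_0 M mu^2 / (1 - M mu).
   The linear part of the left-hand side vanishes because h solves the coarse Newton equation.
   Choosing z = (R H(x_{k+1}) R^T)^{-1} R grad f(x_{k+1}) turns both w^T grad f(x_{k+1}) and
   |w|_1^2 into g(x_{k+1})^2, whence g(x_{k+1}) <= M mu^2 / (1 - M mu)^2; the acceptance condition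
   then bounds sigma * lambda(x_{k+1}). *)
Require Import Defs.
From HB Require Import structures.
From mathcomp Require Import all_boot all_order all_algebra.
From mathcomp Require Import all_classical all_reals all_analysis.
From mathcomp Require Import ring lra.
Import Order.TTheory GRing.Theory Num.Theory.
Import numFieldNormedType.Exports.
Local Open Scope ring_scope.

(** * Directional derivatives *)

(** Both sides have the same difference quotient, so directional derivatives can be handled by
    one-variable calculus. *)
Lemma is_derive_lineP (R : realType) (V : normedModType R) (g : V -> R) (x v : V) (t b : R) :
  is_derive t 1 (fun s => g (x + s *: v)) b <-> is_derive (x + t *: v) v g b.
Proof.
have E : (fun h : R => h^-1 *: (((fun s => g (x + s *: v)) \o shift t) (h *: 1) - g (x + t *: v))) =
  (fun h : R => h^-1 *: ((g \o shift (x + t *: v)) (h *: v) - g (x + t *: v))).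
  apply/funext => h /=; congr (_ *: (g _ - _)).
  by rewrite scalerDl [h *: 1]mulr1 addrCA.
by split=> -[d1 d2]; split; move: d1 d2; rewrite /derivable /derive E.
Qed.

Lemma is_derive_translate (R : realType) (V : normedModType R) (g : V -> R) (x v z : V) (b : R) :
  is_derive (x + z) v g b -> is_derive x v (fun y => g (y + z)) b.
Proof.
have E : (fun h : R => h^-1 *: (((fun y => g (y + z)) \o shift x) (h *: v) - g (x + z))) =
    (fun h : R => h^-1 *: ((g \o shift (x + z)) (h *: v) - g (x + z))).
  by apply/funext => h /=; rewrite addrA.
by move=> [d1 d2]; split; move: d1 d2; rewrite /derivable /derive E.
Qed.

(** Rescaling the line parameter by s -> c s turns this into the one-variable chain rule, with no
    case split on c = 0. *)
Lemma is_derive_dirZ (R : realType) (V : normedModType R) (g : V -> R) (x v : V) (a c : R) :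
  is_derive x v g a -> is_derive x (c *: v) g (c * a).
Proof.
move=> dg.
have dg0 : is_derive (c * 0 : R) 1 (fun s => g (x + s *: v)) a.
  by apply/is_derive_lineP; rewrite mulr0 scale0r addr0.
have dc : is_derive (0 : R) 1 (fun s : R => c * s) c.
  by apply: is_derive_eq; rewrite [c%:A]mulr1.
have := is_derive1_comp (f := (fun s => g (x + s *: v))) (g := fun s : R => c * s) dg0 dc.
rewrite mulrC => dgc.
rewrite -[x]addr0 -[X in x + X](scale0r (c *: v)); apply/is_derive_lineP.
rewrite (_ : (fun s => _) = (fun s => g (x + s *: v)) \o (fun s : R => c * s))//.
by apply/funext => s /=; rewrite scalerA mulrC.
Qed.

(** The mean value theorem is applied on [0, 1] to t -> g(y + t s v), so [s] may have either
    sign. *)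
Lemma MVT_line (R : realType) (V : normedModType R) (g b : V -> R) (v : V) :
  (forall y, is_derive y v g (b y)) -> forall y s,
  exists2 t, 0 <= t <= 1 & g (y + s *: v) - g y = s * b (y + (t * s) *: v).
Proof.
move=> dg y s.
have dl (t : R) : is_derive t 1 (fun t => g (y + t *: (s *: v))) (s * b (y + (t * s) *: v)).
  by apply/is_derive_lineP; rewrite scalerA; apply: is_derive_dirZ.
have cl : {within `[0 : R, 1], continuous (fun t => g (y + t *: (s *: v)))}%classic.
  by apply: derivable_within_continuous => t _; apply: ex_derive.
have [t + E] := @MVT R _ _ 0 1 ltr01 (fun t _ => dl t) cl.
rewrite in_itv/= => /andP[t0 t1]; exists t; first by rewrite !ltW.
by move: E; rewrite scale1r scale0r addr0 subr0 mulr1.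
Qed.

(** The radius is uniform in [p] and [q], because the mean value theorem only asserts that such
    intermediate points exist. *)
Lemma continuous_parallelogram (R : realType) (V : normedModType R) (b : V -> R) (x u v : V) :
  {for x, continuous b} -> forall e : R, 0 < e -> exists2 d, 0 < d &
  forall s p q, `|s| < d -> 0 <= p <= 1 -> 0 <= q <= 1 ->
    (`|b x - b (x + (p * s) *: u + (q * s) *: v)| <= e)%R.
Proof.
move=> /cvgrPdist_le cb e e0.
have /nbhs_ballP[d /= d0 bd] := cb _ e0.
(* The summand 1 keeps [N] positive when [u] and [v] both vanish. *)
pose N := `|u| + `|v| + 1.
have N0 : 0 < N by rewrite ltr_wpDl// addr_ge0.
exists (d / N); first exact: divr_gt0.
move=> s p q sd /andP[p0 p1] /andP[q0 q1]; apply: bd.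
rewrite -ball_normE /= -addrA opprD addNKr normrN.
apply: (@le_lt_trans _ _ (`|s| * N)); last by rewrite -ltr_pdivlMr.
apply: (le_trans (ler_normD _ _)); rewrite !normrZ.
rewrite (ger0_norm p0) (ger0_norm q0) /N !mulrDr mulr1.
rewrite -[leLHS]addr0 lerD ?normr_ge0//.
by rewrite -!mulrA lerD// ler_piMl ?mulr_ge0.
Qed.

(** The increment is split at x + h u: the first quotient converges by hypothesis, and the second is
    a value of [b] at a point tending to [x]. The derivative along [u] is taken at [x] alone, which
    is what an induction over coordinates provides. *)
Lemma is_derive_dirD (R : realType) (V : normedModType R) (g b : V -> R) (x u v : V) (a : R) :
  is_derive x u g a -> (forall y, is_derive y v g (b y)) -> {for x, continuous b} ->
  is_derive x (u + v) g (a + b x).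
Proof.
move=> [dgu <-] dgv cb.
suff cv : ((fun h : R => h^-1 *: ((g \o shift x) (h *: (u + v)) - g x)) @ 0^' -->
    'D_u g x + b x)%classic.
  by split; [apply/cvg_ex; exists ('D_u g x + b x) | apply/cvg_lim].
pose q h := h^-1 *: ((g \o shift x) (h *: u) - g x).
pose w h := h^-1 *: (g (x + h *: u + h *: v) - g (x + h *: u)).
have E : (fun h : R => h^-1 *: ((g \o shift x) (h *: (u + v)) - g x)) = (fun h => q h + w h).
  apply/funext => h; rewrite /q /w -[RHS](scalerDr h^-1) /= [h *: (u + v)]scalerDr.
  rewrite ![_ + x]addrC addrA; congr (_ *: _); ring.
rewrite E; apply: (@cvgD _ _ _ _ _ q w _ _ dgu).
apply/cvgrPdist_le => e e0.
have [d d0 bd] := @continuous_parallelogram R V b x u v cb e e0.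
exists d => //= h /=; rewrite sub0r normrN => hd h0.
rewrite /w; have [t t01 ->] := @MVT_line R V g b v dgv (x + h *: u) h.
rewrite [_ *: _]mulrA mulVf// mul1r.
by have := bd h 1 t hd _ t01; rewrite mul1r lexx ler01 => ->.
Qed.

(** Schwarz's theorem: the second difference over a small parallelogram, divided by s^2, is a value
    near [x] of [guv] or of [gvu], depending on the order in which the mean value theorem is
    applied. *)
Lemma mixed_derivatives_sym (R : realType) (V : normedModType R)
    (g gu gv guv gvu : V -> R) (u v x : V) :
  (forall y, is_derive y u g (gu y)) -> (forall y, is_derive y v g (gv y)) ->
  (forall y, is_derive y v gu (guv y)) -> (forall y, is_derive y u gv (gvu y)) ->
  {for x, continuous guv} -> {for x, continuous gvu} -> guv x = gvu x.
Proof.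
move=> du dv duv dvu cuv cvu.
have shiftd (k : V -> R) dk w z : (forall y, is_derive y w k (dk y)) ->
    forall y, is_derive y w (fun y => k (y + z) - k y) (dk (y + z) - dk y).
  move=> dkw y; apply: is_deriveB.
  exact/is_derive_translate.
have second k ku kuv w z : (forall y, is_derive y w k (ku y)) ->
    (forall y, is_derive y z ku (kuv y)) ->
    forall s, exists p q, [/\ 0 <= p <= 1, 0 <= q <= 1 &
      k (x + s *: w + s *: z) - k (x + s *: w) - (k (x + s *: z) - k x) =
        s * s * kuv (x + (p * s) *: w + (q * s) *: z)].
  move=> dw dz s.
  have [p p01 ->] := MVT_line _ _ _ _ _ (shiftd _ _ _ (s *: z) dw) x s.
  have [q q01 ->] := MVT_line _ _ _ _ _ dz (x + (p * s) *: w) s.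
  by exists p, q; split => //; rewrite mulrA.
apply/eqP; rewrite -subr_eq0 -normr_le0; apply/ler_addgt0Pl => e e0; rewrite addr0.
have e20 : 0 < e / 2 by rewrite divr_gt0.
have [d1 d10 b1] := continuous_parallelogram _ _ _ x u v cuv _ e20.
have [d2 d20 b2] := continuous_parallelogram _ _ _ x v u cvu _ e20.
pose s := Num.min d1 d2 / 2.
have s0 : 0 < s by rewrite divr_gt0// lt_min d10.
have sd : s < Num.min d1 d2 by rewrite ltr_pdivrMr// ltr_pMr ?lt_min ?d10// ltr1n.
move: sd; rewrite lt_min => /andP[sd1 sd2].
have [p [q [p01 q01 E1]]] := second _ _ _ _ _ du duv s.
have [p' [q' [p'01 q'01 E2]]] := second _ _ _ _ _ dv dvu s.
have E : guv (x + (p * s) *: u + (q * s) *: v) = gvu (x + (p' * s) *: v + (q' * s) *: u).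
  apply: (@mulfI _ (s * s)); first by rewrite mulf_neq0// gt_eqF.
  rewrite -E1 -E2 [x + s *: v + _]addrAC; ring.
have := b1 s p q; rewrite gtr0_norm// => /(_ sd1 p01 q01) h1.
have := b2 s p' q'; rewrite gtr0_norm// => /(_ sd2 p'01 q'01) h2.
rewrite (splitr e) (le_trans (ler_distD (guv (x + (p * s) *: u + (q * s) *: v)) _ _))//.
by rewrite lerD// E distrC.
Qed.

Lemma continuously_differentiableW (R : realType) (n k : nat) (g : 'cV[R]_n -> R) :
  continuously_differentiable k.+1 g -> continuously_differentiable k g.
Proof.
elim: k g => [|k IH] g [cg dg]; first exact: cg.
by split=> // i; have [dig /IH] := dg i.
Qed.

(** The coordinates of [h] are added one at a time with [is_derive_dirD], where continuity of the
    partial derivatives enters. *)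
Lemma is_derive_C1 (R : realType) (n : nat) (g : 'cV[R]_n -> R) (x h : 'cV[R]_n) :
  continuously_differentiable 1 g -> is_derive x h g (\sum_i h i 0 * partial i g x).
Proof.
move=> [_ dg].
have Eh : h = \sum_i h i 0 *: delta_mx i 0.
  by rewrite {1}[h]matrix_sum_delta; apply: eq_bigr => i _; rewrite big_ord1.
rewrite {1}Eh; elim: (index_enum _) => [|i s IH]; first by rewrite !big_nil; exact: is_derive0.
rewrite !big_cons addrC [_ * _ + _]addrC.
apply: (@is_derive_dirD _ _ g (fun y => h i 0 * partial i g y)) => // [y|].
  by apply: is_derive_dirZ; split => //; case: (dg i).
by apply: continuousM; [exact: cst_continuous | case: (dg i) => _; exact].
Qed.

Lemma is_derive_lincomb (R : realType) (V : normedModType R) (I : finType) (c : I -> R)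
    (F : I -> V -> R) (D : I -> R) (x v : V) :
  (forall i, is_derive x v (F i) (D i)) ->
  is_derive x v (fun y => \sum_i c i * F i y) (\sum_i c i * D i).
Proof.
move=> dF; elim: (index_enum _) => [|i s IH].
  by rewrite big_nil; under eq_fun do rewrite big_nil; exact: is_derive_cst.
rewrite big_cons; under eq_fun do rewrite big_cons.
by apply: is_deriveD; apply: is_deriveZ.
Qed.

(** * Derivatives of the gradient and the Hessian along a line *)

Section Line.
Context {R : realType} {n : nat} {f : 'cV[R]_n -> R}.
Hypothesis f3 : continuously_differentiable 3 f.

Lemma C3_partial2 i j : continuously_differentiable 1 (partial i (partial j f)).
Proof. by case: f3 => _ /(_ j)[_ [_ /(_ i)[]]]. Qed.

Lemma bilinear_formE p (A : 'M[R]_p) (u w : 'cV[R]_p) :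
  (u^T *m A *m w) 0 0 = \sum_i \sum_j A i j * u i 0 * w j 0.
Proof.
rewrite -mulmxA mxE; apply: eq_bigr => i _; rewrite !mxE mulr_sumr.
by apply: eq_bigr => j _; rewrite mulrA [A i j * _]mulrC.
Qed.

(** The derivative along the line is the outermost one, so [h] comes first in the result. *)
Lemma is_derive_gradient_line (x h w : 'cV[R]_n) (t : R) :
  is_derive t 1 (fun s => (w^T *m gradient f (x + s *: h)) 0 0)
    ((h^T *m hessian f (x + t *: h) *m w) 0 0).
Proof.
apply/(@is_derive_lineP R _ (fun y => (w^T *m gradient f y) 0 0) x h t).
have d1 i : is_derive (x + t *: h) h (partial i f)
    (\sum_j h j 0 * partial j (partial i f) (x + t *: h)).
  by apply: is_derive_C1; apply: continuously_differentiableW; case: f3 => _ /(_ i)[].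
have := is_derive_lincomb _ _ _ (fun i => w i 0) _ _ _ _ d1.
rewrite (_ : (fun y => _) = (fun y => (w^T *m gradient f y) 0 0)); last first.
  by apply/funext => y; rewrite mxE; apply: eq_bigr => i _; rewrite !mxE.
congr is_derive; rewrite bilinear_formE exchange_big; apply: eq_bigr => i _ /=.
by rewrite mulr_sumr; apply: eq_bigr => j _; rewrite mxE; ring.
Qed.

Lemma is_derive_hessian_line (x h u w : 'cV[R]_n) (t : R) :
  is_derive t 1 (fun s => (u^T *m hessian f (x + s *: h) *m w) 0 0)
    (third_derivative f (x + t *: h) h u w).
Proof.
apply/(@is_derive_lineP R _ (fun y => (u^T *m hessian f y *m w) 0 0) x h t).
have d1 i : is_derive (x + t *: h) h (fun y => \sum_j w j 0 * partial i (partial j f) y)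
    (\sum_j w j 0 * \sum_l h l 0 * partial l (partial i (partial j f)) (x + t *: h)).
  by apply: is_derive_lincomb => j; apply: is_derive_C1; exact: C3_partial2.
have := is_derive_lincomb _ _ _ (fun i => u i 0) _ _ _ _ d1.
rewrite (_ : (fun y => _) = (fun y => (u^T *m hessian f y *m w) 0 0)); last first.
  apply/funext => y; rewrite bilinear_formE; apply: eq_bigr => i _; rewrite mulr_sumr.
  by apply: eq_bigr => j _; rewrite mxE; ring.
congr is_derive; rewrite /third_derivative exchange_big; apply: eq_bigr => i _ /=.
rewrite mulr_sumr exchange_big; apply: eq_bigr => j _ /=.
by rewrite mulrA mulr_sumr; apply: eq_bigr => l _; ring.
Qed.

Hypothesis hess_sym : forall y, (hessian f y)^T = hessian f y.

(** The two inner derivatives form a Hessian entry, and the Hessian is symmetric at every point, so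
    they commute as functions before the third derivative is taken. *)
Lemma third_derivative_symr x u v w : third_derivative f x u v w = third_derivative f x u w v.
Proof.
apply: eq_bigr => i _; rewrite exchange_big; apply: eq_bigr => j _; apply: eq_bigr => l _ /=.
have -> : partial l (partial j f) = partial j (partial l f).
  by apply/funext => y; have /matrixP/(_ j l) := hess_sym y; rewrite !mxE.
by ring.
Qed.

(** The two outer derivatives act on [partial l f], which is of class C^2, so Schwarz's theorem
    exchanges them. *)
Lemma third_derivative_syml x u v w : third_derivative f x u v w = third_derivative f x v u w.
Proof.
rewrite /third_derivative exchange_big; apply: eq_bigr => i _; apply: eq_bigr => j _.
apply: eq_bigr => l _ /=.
have C2 : continuously_differentiable 2 (partial l f) by case: f3 => _ /(_ l)[].
have d1 a y : is_derive y (delta_mx a 0) (partial l f) (partial a (partial l f) y).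
  by split => //; case: C2 => _ /(_ a)[].
have d2 a b y : is_derive y (delta_mx b 0) (partial a (partial l f))
    (partial b (partial a (partial l f)) y).
  by split => //; case: C2 => _ /(_ a)[_ [_ /(_ b)[]]].
have c2 a b : {for x, continuous (partial b (partial a (partial l f)))}.
  by case: C2 => _ /(_ a)[_ [_ /(_ b)[_]]]; exact.
rewrite (mixed_derivatives_sym _ _ _ _ _ _ _ _ _ _ (d1 i) (d1 j) (d2 i j) (d2 j i)
  (c2 i j) (c2 j i)).
by ring.
Qed.

End Line.

(** * Polarization of cubic forms *)

(* With (c, s) = (cos t, sin t) and r = sqrt 3, the nodes are the points of angle t, t + pi/3 and
   t + 2 pi/3, the left-hand side is cos(3t) a + sin(3t) b, and W is a Fejer kernel. *)
Lemma riesz_interpolation (R : realFieldType) (a b p q c s r : R) :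
  let F x y := a * x ^+ 3 + 3 * b * x ^+ 2 * y + 3 * p * x * y ^+ 2 + q * y ^+ 3 in
  let W x : R := ((4 * x ^+ 2 - 1) / 3) ^+ 2 in
  c ^+ 2 + s ^+ 2 = 1 -> r ^+ 2 = 3 ->
  (4 * c ^+ 3 - 3 * c) * a + (3 * s - 4 * s ^+ 3) * b =
  W c * F c s - W ((c - r * s) / 2) * F ((c - r * s) / 2) ((s + r * c) / 2)
  + W ((c + r * s) / 2) * F (- (c + r * s) / 2) ((r * c - s) / 2).
Proof.
move=> F W cs r3; rewrite /F /W.
have s2 : s ^+ 2 = 1 - c ^+ 2 by rewrite -cs [c ^+ 2 + _]addrC addrK.
by field: s2 r3.
Qed.

(** These are the triple-angle formulas at a third of [acos al]; the sign of [be] makes it the sine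
    of [acos al]. *)
Lemma angle_trisection (R : realType) (al be : R) : al ^+ 2 + be ^+ 2 = 1 -> 0 <= be ->
  exists c s, [/\ c ^+ 2 + s ^+ 2 = 1, al = 4 * c ^+ 3 - 3 * c & be = 3 * s - 4 * s ^+ 3].
Proof.
move=> ab be0.
have al1 : -1 <= al <= 1.
  by rewrite -ler_norml -(@ler_pXn2r _ 2)// ?nnegrE// expr1n real_normK ?num_real//
    -ab lerDl sqr_ge0.
pose th := acos al / 3; have th3 : acos al = th + th + th by rewrite /th; field.
have cs := cos2Dsin2 th.
have s2 : sin th ^+ 2 = 1 - cos th ^+ 2 by rewrite -cs [_ + sin th ^+ 2]addrC addrK.
exists (cos th), (sin th); split => //.
  rewrite -[LHS](@acosK R) ?in_itv//= th3 !cosD !sinD; ring: s2.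
have -> : be = sin (acos al).
  by rewrite sin_acos// -ab addrC addKr sqrtr_sqr ger0_norm.
rewrite th3 !sinD !cosD.
ring: s2.
Qed.

(* The Bernstein-Szego inequality p(0)^2 + (p'(0)/3)^2 <= sup p^2 for the trigonometric
   polynomial p(t) = F(cos t, sin t). *)
Lemma cubic_form_bound (R : realType) (a b p q K al be : R) :
  (forall x y, x ^+ 2 + y ^+ 2 = 1 ->
    `|a * x ^+ 3 + 3 * b * x ^+ 2 * y + 3 * p * x * y ^+ 2 + q * y ^+ 3| <= K) ->
  al ^+ 2 + be ^+ 2 = 1 -> 0 <= be -> `|al * a + be * b| <= K.
Proof.
move=> FK ab be0; have [c [s [cs -> ->]]] := angle_trisection _ _ _ ab be0.
have r3 : (Num.sqrt 3 : R) ^+ 2 = 3 by rewrite sqr_sqrtr.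
move: (Num.sqrt 3) r3 => r r3.
rewrite (riesz_interpolation _ a b p q c s r cs r3).
have s2 : s ^+ 2 = 1 - c ^+ 2 by rewrite -cs [c ^+ 2 + _]addrC addrK.
have F0 := FK c s cs.
have F1 := FK ((c - r * s) / 2) ((s + r * c) / 2) ltac:(by field: s2 r3).
have F2 := FK (- (c + r * s) / 2) ((r * c - s) / 2) ltac:(by field: s2 r3).
(* The three kernel weights are squares with sum 1, so the interpolation formula is a convex
   combination of values of F up to sign. *)
have -> : K = ((4 * c ^+ 2 - 1) / 3) ^+ 2 * K
    + ((4 * ((c - r * s) / 2) ^+ 2 - 1) / 3) ^+ 2 * K
    + ((4 * ((c + r * s) / 2) ^+ 2 - 1) / 3) ^+ 2 * K by field: s2 r3.
apply: (le_trans (ler_normD _ _)); apply: lerD; last first.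
  by rewrite normrM ger0_norm ?sqr_ge0// ler_wpM2l ?sqr_ge0.
apply: (le_trans (ler_normB _ _)); apply: lerD.
  by rewrite normrM ger0_norm ?sqr_ge0// ler_wpM2l ?sqr_ge0.
by rewrite normrM ger0_norm ?sqr_ge0// ler_wpM2l ?sqr_ge0.
Qed.

(** * Symmetric trilinear forms on an inner product space *)

Section Polarization.
Context {R : realType} {V : lmodType R} (Q : V -> V -> R) (T : V -> V -> V -> R).
Hypothesis Q_sym : forall u v, Q u v = Q v u.
Hypothesis Q_lin : forall a u v w, Q (a *: u + v) w = a * Q u w + Q v w.
Hypothesis Q_pos : forall u, u != 0 -> 0 < Q u u.
Hypothesis T_syml : forall u v w, T u v w = T v u w.
Hypothesis T_symr : forall u v w, T u v w = T u w v.
Hypothesis T_lin : forall a u v w z, T (a *: u + v) w z = a * T u w z + T v w z.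

Let Q0 w : Q 0 w = 0.
Proof. by have := Q_lin 1 0 0 w; rewrite scaler0 addr0 mul1r; lra. Qed.

Let T0 w z : T 0 w z = 0.
Proof. by have := T_lin 1 0 0 w z; rewrite scaler0 addr0 mul1r; lra. Qed.

Let QZ a u w : Q (a *: u) w = a * Q u w.
Proof. by rewrite -[a *: u]addr0 Q_lin Q0 addr0. Qed.

Let QZr a u w : Q w (a *: u) = a * Q w u.
Proof. by rewrite !(Q_sym w) QZ. Qed.

Let QD u v w : Q (u + v) w = Q u w + Q v w.
Proof. by rewrite -[u]scale1r Q_lin scale1r mul1r. Qed.

Let QDr u v w : Q w (u + v) = Q w u + Q w v.
Proof. by rewrite !(Q_sym w) QD. Qed.

Let TZ a u w z : T (a *: u) w z = a * T u w z.
Proof. by rewrite -[a *: u]addr0 T_lin T0 addr0. Qed.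

Let TZ2 a u w z : T w (a *: u) z = a * T w u z.
Proof. by rewrite !(T_syml w) TZ. Qed.

Let TZ3 a u w z : T w z (a *: u) = a * T w z u.
Proof. by rewrite !(T_symr w z) TZ2. Qed.

Let TD u v w z : T (u + v) w z = T u w z + T v w z.
Proof. by rewrite -[u]scale1r T_lin scale1r mul1r. Qed.

Let TD2 u v w z : T w (u + v) z = T w u z + T w v z.
Proof. by rewrite !(T_syml w) TD. Qed.

Let TD3 u v w z : T w z (u + v) = T w z u + T w z v.
Proof. by rewrite !(T_symr w z) TD2. Qed.

Let Q_ge0 u : 0 <= Q u u.
Proof. by have [->|/Q_pos/ltW//] := eqVneq u 0; rewrite Q0. Qed.

(** Gram-Schmidt writes w = al u + be e with [u], [e] orthonormal and al^2 + be^2 = 1. On the plane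
    they span, the cube of T is a binary cubic form bounded by [K] on the unit circle, so
    [cubic_form_bound] applies. *)
Lemma polarization_unit (K : R) (u w : V) : 0 <= K ->
  (forall v, Q v v <= 1 -> `|T v v v| <= K) ->
  Q u u = 1 -> Q w w = 1 -> `|T w u u| <= K.
Proof.
move=> K0 TK u1 w1.
pose al := Q u w; pose y := w - al *: u.
have Ey : w = al *: u + y by rewrite /y addrC subrK.
have uy : Q u y = 0.
  by rewrite /y -scaleNr QDr QZr u1 mulr1 subrr.
clearbody y al.
have yy : Q y y = 1 - al ^+ 2.
  have := w1; rewrite Ey !(QD, QDr, QZ, QZr) u1 uy (Q_sym y u) uy; move=> E; rewrite -E; ring.
(* If y = 0 then [w] is [u] or its opposite, and there is no second direction to normalize. *)
have [y0|y0] := eqVneq y 0.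
  have al2 : al ^+ 2 = 1 by apply/eqP; rewrite eq_sym -subr_eq0 -yy y0 Q0.
  rewrite Ey y0 addr0 TZ normrM; suff -> : `|al| = 1 by rewrite mul1r TK ?u1.
  by apply/eqP; rewrite -sqrp_eq1// real_normK ?num_real// al2.
pose be := Num.sqrt (Q y y).
have be0 : 0 < be by rewrite sqrtr_gt0 Q_pos.
have be2 : be ^+ 2 = Q y y by rewrite sqr_sqrtr.
pose e := be^-1 *: y.
have Ee : y = be *: e by rewrite scalerA mulfV ?gt_eqF// scale1r.
have ue : Q u e = 0.
  by rewrite QZr uy mulr0.
have e1 : Q e e = 1.
  by rewrite QZ QZr -be2; field; rewrite gt_eqF.
clearbody e.
have -> : T w u u = al * T u u u + be * T u u e.
  by rewrite Ey TD TZ Ee TZ (T_syml e) (T_symr u e).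
apply: (cubic_form_bound _ _ _ (T u e e) (T e e e)) => [s t st||]; last exact: ltW.
  have -> : T u u u * s ^+ 3 + 3 * T u u e * s ^+ 2 * t + 3 * T u e e * s * t ^+ 2
      + T e e e * t ^+ 3
    = T (s *: u + t *: e) (s *: u + t *: e) (s *: u + t *: e).
    rewrite !(TD, TD2, TD3, TZ, TZ2, TZ3).
    by rewrite (T_syml e u u) (T_symr u e u) (T_syml e u e) (T_symr e e u)
      (T_syml e u e); ring.
  apply: TK; rewrite !(QD, QDr, QZ, QZr) u1 ue e1 (Q_sym e u) ue.
  by lra.
by rewrite be2 yy addrC subrK.
Qed.

(** Banach's theorem that a symmetric form on an inner product space has the same norm as its
    diagonal, so [K] does not grow. Homogeneity reduces it to unit vectors. *)
Lemma polarization (K : R) (u w : V) : 0 <= K ->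
  (forall v, `|T v v v| <= K * Num.sqrt (Q v v) ^+ 3) ->
  `|T w u u| <= K * Num.sqrt (Q w w) * Q u u.
Proof.
move=> K0 TK.
have [->|u0] := eqVneq u 0; first by rewrite T_syml T0 normr0 !mulr_ge0 ?sqrtr_ge0.
have [->|w0] := eqVneq w 0; first by rewrite T0 normr0 !mulr_ge0 ?sqrtr_ge0.
have unit v : v != 0 -> exists nv v1, [/\ 0 < nv, nv ^+ 2 = Q v v, Q v1 v1 = 1 & v = nv *: v1].
  move=> v0; have nv0 : 0 < Num.sqrt (Q v v) by rewrite sqrtr_gt0 Q_pos.
  exists (Num.sqrt (Q v v)), ((Num.sqrt (Q v v))^-1 *: v); split => //.
  - by rewrite sqr_sqrtr.
  - by rewrite QZ QZr mulrA -invfM -expr2 sqr_sqrtr// mulVf// gt_eqF// Q_pos.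
  - by rewrite scalerA mulfV ?scale1r// gt_eqF.
have [nu [u1 [nu0 <- Qu Eu]]] := unit u u0.
have [nw [w1 [nw0 <- Qw Ew]]] := unit w w0.
have -> : T w u u = nw * nu ^+ 2 * T w1 u1 u1.
  by rewrite Eu Ew !(TZ, TZ2, TZ3); ring.
rewrite sqrtr_sqr (gtr0_norm nw0) normrM gtr0_norm ?mulr_gt0 ?exprn_gt0// mulrC -mulrA.
apply: ler_wpM2r; first by rewrite ltW ?mulr_gt0 ?exprn_gt0.
apply: polarization_unit => // v Qv; apply: (le_trans (TK v)); rewrite ler_piMr//.
by rewrite exprn_ile1 ?sqrtr_ge0// -sqrtr1 ler_wsqrtr.
Qed.
End Polarization.

(** * Scalar differential inequalities *)

Section ScalarComparison.
Context {R : realType}.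
Implicit Types (F p : R -> R) (k t : R).

Lemma le_derive_bound F (F' : R -> R) (B : R) : (forall t, 0 <= t <= 1 -> is_derive t 1 F (F' t)) ->
  (forall t, 0 <= t <= 1 -> F' t <= B) -> forall t, 0 <= t <= 1 -> F t <= F 0 + B * t.
Proof.
move=> dF F'B t /andP[t0 t1].
have in01 s : s \in `[0, t] -> 0 <= s <= 1.
  by rewrite in_itv/= => /andP[-> /le_trans ->].
have dFt s : s \in `]0, t[ -> is_derive s 1 F (F' s).
  by move=> st; apply/dF/in01/(subset_itvW _ _ _ _ st).
have cF : {within `[0, t], continuous F}%classic.
  by apply: derivable_within_continuous => s /in01/dF ds; apply: ex_derive.
have [s st E] := MVT_segment t0 dFt cF.
by rewrite -lerBlDl E subr0 ler_wpM2r// F'B// in01.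
Qed.

Lemma is_derive_geometric k t : 1 - k * t != 0 ->
  is_derive t 1 (fun s => (1 - k * s)^-1) (k * (1 - k * t)^-1 ^+ 2).
Proof.
move=> kt; have dl : is_derive t 1 (fun s => 1 - k * s) (- k).
  apply: is_derive_eq; rewrite /GRing.scale /=; ring.
apply: (is_derive_eq (is_deriveV (f := fun s => 1 - k * s) kt dl)).
by rewrite [LHS]mulrNN mulrC exprVn.
Qed.

Lemma is_derive_sqr F (a t : R) : is_derive t 1 F a ->
  is_derive t 1 (fun s => F s ^+ 2) (2 * F t * a).
Proof.
move=> dF; under eq_fun do rewrite expr2.
by apply: (is_derive_eq (is_deriveM dF dF)); rewrite /GRing.scale/=; ring.
Qed.

Lemma sub1_gt0 k t : 0 <= k < 1 -> 0 <= t <= 1 -> 0 < 1 - k * t.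
Proof. by move=> /andP[k0 k1] /andP[t0 t1]; nra. Qed.

(** The function - p^(-1/2) has derivative p' / (2 p^(3/2)), which is at most [M]; integrating and
    inverting gives the bound. *)
Lemma sqrt_growth p (p' : R -> R) (M mu : R) :
  0 < mu -> 0 <= M -> M * mu < 1 -> p 0 = mu ^+ 2 -> (forall t, 0 < p t) ->
  (forall t, is_derive t 1 p (p' t)) ->
  (forall t, `|p' t| <= 2 * M * Num.sqrt (p t) ^+ 3) ->
  forall t, 0 <= t <= 1 -> Num.sqrt (p t) <= mu / (1 - M * mu * t).
Proof.
move=> mu0 M0 Mmu1 pmu p0 dp bp t t01.
have kt : 0 < 1 - M * mu * t by rewrite sub1_gt0// Mmu1 mulr_ge0// ltW.
have s0 s : 0 < Num.sqrt (p s) by rewrite sqrtr_gt0.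
have dF (s : R) : is_derive s 1 (fun s => - (Num.sqrt (p s))^-1)
    ((Num.sqrt (p s))^-1 ^+ 2 * ((2 * Num.sqrt (p s))^-1 * p' s)).
  have dsq := is_derive1_comp (is_derive1_sqrt (p0 s)) (dp s).
  have nz : (Num.sqrt \o p) s != 0 := lt0r_neq0 (s0 s).
  have := is_deriveN (is_deriveV nz dsq).
  move=> dN; apply: (is_derive_eq dN); rewrite /= [- _ ^- 2 *: _]mulNr opprK exprVn//.
have FB (s : R) : (Num.sqrt (p s))^-1 ^+ 2 * ((2 * Num.sqrt (p s))^-1 * p' s) <= M.
  have := bp s; move: (s0 s); move: (Num.sqrt _) => q q0.
  rewrite ler_norml => /andP[_ pq].
  rewrite [leLHS](_ : _ = p' s / (2 * q ^+ 3)); last by field; rewrite gt_eqF.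
  by rewrite ler_pdivrMr ?mulr_gt0 ?exprn_gt0//; lra.
have := le_derive_bound _ _ _ (fun s _ => dF s) (fun s _ => FB s) t t01.
rewrite pmu sqrtr_sqr gtr0_norm// => h.
have : (1 - M * mu * t) / mu <= (Num.sqrt (p t))^-1.
  have -> : (1 - M * mu * t) / mu = mu^-1 - M * t by field; rewrite gt_eqF.
  by lra.
by rewrite -invf_div lef_pV2 // ?posrE ?divr_gt0 ?invr_gt0.
Qed.

(** On [0, 1], p (1 - k t)^2 is nonincreasing and p (1 - k t)^(-2) is nondecreasing. These
    integrating factors replace the logarithm of [p], as [p] may vanish. *)
Lemma log_growth p (p' : R -> R) k :
  0 <= k < 1 -> (forall t, 0 <= p t) ->
  (forall t, is_derive t 1 p (p' t)) ->
  (forall t, 0 <= t <= 1 -> `|p' t| <= 2 * k * (1 - k * t)^-1 * p t) ->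
  forall t, 0 <= t <= 1 ->
    p t <= p 0 * (1 - k * t)^-1 ^+ 2 /\ p 0 * (1 - k * t) ^+ 2 <= p t.
Proof.
move=> k01 p0 dp bp t t01; split.
  have dF (s : R) : 0 <= s <= 1 -> is_derive s 1 (fun s => p s * (1 - k * s) ^+ 2)
      ((1 - k * s) * (p' s * (1 - k * s) - 2 * k * p s)).
    move=> s01; have dl : is_derive s 1 (fun s => (1 - k * s) ^+ 2) (- (2 * k * (1 - k * s))).
      by apply: is_derive_eq; rewrite /GRing.scale/=; ring.
    by apply: (is_derive_eq (is_deriveM (dp s) dl)); rewrite /GRing.scale/=; ring.
  have FB (s : R) : 0 <= s <= 1 -> (1 - k * s) * (p' s * (1 - k * s) - 2 * k * p s) <= 0.
    move=> s01; have ks := sub1_gt0 _ _ k01 s01.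
    rewrite pmulr_rle0// subr_le0 -ler_pdivlMr//.
    by apply: le_trans (le_trans (ler_norm _) (bp s s01)) _; rewrite mulrAC.
  have := le_derive_bound _ _ _ dF FB t t01.
  rewrite mulr0 subr0 expr1n mulr1 mul0r addr0 exprVn -ler_pdivlMr ?exprn_gt0//.
  exact: sub1_gt0.
have dF (s : R) : 0 <= s <= 1 -> is_derive s 1 (fun s => - (p s * (1 - k * s)^-1 ^+ 2))
    (- ((1 - k * s)^-1 ^+ 2 * (p' s + 2 * k * (1 - k * s)^-1 * p s))).
  move=> s01; have ks : 1 - k * s != 0 by rewrite gt_eqF// sub1_gt0.
  have dl := is_derive_sqr _ _ _ (is_derive_geometric _ _ ks).
  by apply: (is_derive_eq (is_deriveN (is_deriveM (dp s) dl))); rewrite /GRing.scale/=; ring.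
have FB (s : R) : 0 <= s <= 1 ->
    - ((1 - k * s)^-1 ^+ 2 * (p' s + 2 * k * (1 - k * s)^-1 * p s)) <= 0.
  move=> s01; rewrite oppr_le0 mulr_ge0 ?sqr_ge0//.
  by have := bp s s01; rewrite ler_norml => /andP[+ _]; lra.
have := le_derive_bound _ _ _ dF FB t t01.
rewrite mulr0 subr0 invr1 expr1n mulr1 mul0r addr0 lerN2 exprVn ler_pdivlMr ?exprn_gt0//.
exact: sub1_gt0.
Qed.

(** The bound on [X2] is the second derivative of c / (1 - k t). Subtracting this function and
    integrating twice leaves c (1 / (1 - k) - 1 - k). *)
Lemma taylor_growth (X X1 X2 : R -> R) (c k : R) :
  0 <= k < 1 -> (forall t, is_derive t 1 X (X1 t)) -> (forall t, is_derive t 1 X1 (X2 t)) ->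
  (forall t, 0 <= t <= 1 -> X2 t <= 2 * c * k ^+ 2 * (1 - k * t)^-1 ^+ 3) ->
  X 1 - X 0 - X1 0 <= c * k ^+ 2 / (1 - k).
Proof.
move=> k01 dX dX1 bX.
pose u t := (1 - k * t)^-1.
have u0 : u 0 = 1 by rewrite /u mulr0 subr0 invr1.
have du (t : R) : 0 <= t <= 1 -> is_derive t 1 u (k * u t ^+ 2).
  by move=> t01; apply: is_derive_geometric; rewrite gt_eqF// sub1_gt0.
have dF (t : R) : 0 <= t <= 1 -> is_derive t 1 (fun t => X1 t - c * k * u t ^+ 2)
    (X2 t - 2 * c * k ^+ 2 * u t ^+ 3).
  move=> t01; have dl := is_deriveZ (c * k) (is_derive_sqr _ _ _ (du t t01)).
  by apply: (is_derive_eq (is_deriveB (dX1 t) dl)); rewrite /GRing.scale/=; ring.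
have FB (t : R) : 0 <= t <= 1 -> X2 t - 2 * c * k ^+ 2 * u t ^+ 3 <= 0.
  by move=> t01; rewrite subr_le0 bX.
have h1 := le_derive_bound _ _ _ dF FB.
have dG (t : R) : 0 <= t <= 1 -> is_derive t 1 (fun t => X t - c * u t) (X1 t - c * k * u t ^+ 2).
  move=> t01; have dl := is_deriveZ c (du t t01).
  by apply: (is_derive_eq (is_deriveB (dX t) dl)); rewrite /GRing.scale/=; ring.
have GB (t : R) : 0 <= t <= 1 -> X1 t - c * k * u t ^+ 2 <= X1 0 - c * k.
  by move=> t01; apply: le_trans (h1 t t01) _; rewrite u0; lra.
have := le_derive_bound _ _ _ dG GB 1; rewrite ler01 lexx => /(_ isT).
have -> : c * k ^+ 2 / (1 - k) = c * u 1 - c - c * k.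
  by rewrite /u mulr1; field; case/andP: k01 => _; rewrite -subr_gt0 => /gt_eqF ->.
by rewrite u0; lra.
Qed.

(** Here [a] and [b] stand for the squared local norms of h and w at x + t h, and [X] for w^T grad
    f. The alternative on [a] distinguishes a nonzero from a zero step, since [sqrt_growth] divides
    by the square root of [a]. *)
Lemma self_concordant_segment (M : R) (a a' b b' X X1 X2 : R -> R) :
  0 < M -> M * Num.sqrt (a 0) < 1 ->
  (forall t, 0 < a t) \/ (forall t, a t = 0) -> (forall t, 0 <= b t) ->
  (forall t, is_derive t 1 a (a' t)) -> (forall t, is_derive t 1 b (b' t)) ->
  (forall t, is_derive t 1 X (X1 t)) -> (forall t, is_derive t 1 X1 (X2 t)) ->
  (forall t, `|a' t| <= 2 * M * Num.sqrt (a t) ^+ 3) ->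
  (forall t, `|b' t| <= 2 * M * Num.sqrt (a t) * b t) ->
  (forall t, `|X2 t| <= 2 * M * Num.sqrt (b t) * a t) ->
  b 0 * (1 - M * Num.sqrt (a 0)) ^+ 2 <= b 1 /\
  X 1 - X 0 - X1 0 <= Num.sqrt (b 0) * M * Num.sqrt (a 0) ^+ 2 / (1 - M * Num.sqrt (a 0)).
Proof.
move=> M0 k1 a0 b0 da db dX dX1 ba bb bX; set mu := Num.sqrt (a 0) in k1 *.
have k01 : 0 <= M * mu < 1 by rewrite k1 mulr_ge0 ?sqrtr_ge0// ltW.
have a_ge0 t : 0 <= a t by case: a0 => [/(_ t)/ltW//|->].
have na (t : R) : 0 <= t <= 1 -> Num.sqrt (a t) <= mu / (1 - M * mu * t).
  move=> t01; case: a0 => [a_gt0|a_eq0].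
    apply: (sqrt_growth a a') => //; [by rewrite sqrtr_gt0 | exact: ltW | by rewrite sqr_sqrtr].
  by rewrite /mu !a_eq0 sqrtr0 mul0r.
have nb (t : R) : 0 <= t <= 1 -> `|b' t| <= 2 * (M * mu) * (1 - M * mu * t)^-1 * b t.
  move=> t01; apply: (le_trans (bb t)); rewrite ler_wpM2r//.
  by have := na t t01; nra.
have gb := log_growth _ _ _ k01 b0 db nb; split.
  by have [|_] := gb 1; rewrite ?ler01 ?lexx// mulr1.
(* This exhibits the constants of [taylor_growth]: k = M mu and c = |w|_0 / M. *)
have -> : Num.sqrt (b 0) * M * mu ^+ 2 / (1 - M * mu) =
    Num.sqrt (b 0) / M * (M * mu) ^+ 2 / (1 - M * mu).
  by field; rewrite !gt_eqF ?subr_gt0.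
apply: (taylor_growth X X1 X2) => // t t01.
have kt := sub1_gt0 _ _ k01 t01; have [nbt _] := gb t t01.
have {}nbt : Num.sqrt (b t) <= Num.sqrt (b 0) / (1 - M * mu * t).
  rewrite -(@ler_pXn2r _ 2)// ?nnegrE ?sqrtr_ge0 ?divr_ge0 ?sqrtr_ge0 ?(ltW kt)//.
  by rewrite exprMn !sqr_sqrtr.
apply: (le_trans (le_trans (ler_norm _) (bX t))); rewrite -[a t]sqr_sqrtr//.
have -> : 2 * (Num.sqrt (b 0) / M) * (M * mu) ^+ 2 * (1 - M * mu * t)^-1 ^+ 3 =
   2 * M * (Num.sqrt (b 0) / (1 - M * mu * t)) * (mu / (1 - M * mu * t)) ^+ 2.
  by field; rewrite !gt_eqF.
apply: ler_pM; rewrite ?sqr_ge0 ?mulr_ge0 ?sqrtr_ge0 ?(ltW M0)//.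
  by rewrite ler_wpM2l// mulr_ge0// ltW.
by rewrite ler_pXn2r// ?nnegrE ?sqrtr_ge0 ?na// divr_ge0 ?sqrtr_ge0// ltW.
Qed.

(** The first estimate gives N <= g / (1 - M mu). Inserted into the second, it leaves one factor [g]
    to cancel when g is nonzero; the result is increasing in [mu], which is then replaced by [l]. *)
Lemma decrement_bound (M mu l g N : R) : 0 < M -> 0 <= mu <= l -> M * l < 1 -> 0 <= g -> 0 <= N ->
  N ^+ 2 * (1 - M * mu) ^+ 2 <= g ^+ 2 -> g ^+ 2 <= N * M * mu ^+ 2 / (1 - M * mu) ->
  g <= M * l ^+ 2 / (1 - M * l) ^+ 2.
Proof.
move=> M0 /andP[mu0 mul] Ml1 g0 N0 low rem.
have Mmul : M * mu <= M * l by rewrite ler_wpM2l// ltW.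
have k0 : 0 < 1 - M * mu by lra.
have l0 : 0 < 1 - M * l by lra.
have {}low : N <= g / (1 - M * mu).
  rewrite ler_pdivlMr// -(@ler_pXn2r _ 2)// ?nnegrE//; first by rewrite exprMn.
  by rewrite mulr_ge0// ltW.
have g_mu : g <= M * mu ^+ 2 / (1 - M * mu) ^+ 2.
  have [->|g_neq0] := eqVneq g 0; first by rewrite divr_ge0 ?sqr_ge0// mulr_ge0 ?sqr_ge0// ltW.
  have g_gt0 : 0 < g by rewrite lt0r g_neq0.
  rewrite -(ler_pM2l g_gt0) -expr2; apply: (le_trans rem).
  have -> : g * (M * mu ^+ 2 / (1 - M * mu) ^+ 2) =
      g / (1 - M * mu) * M * mu ^+ 2 / (1 - M * mu) by field; rewrite !gt_eqF.
  do 3 (apply: ler_wpM2r; first by rewrite ?invr_ge0 ?sqr_ge0 ?(ltW k0) ?(ltW M0)).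
  exact: low.
apply: (le_trans g_mu); apply: ler_pM.
- by rewrite mulr_ge0 ?sqr_ge0// ltW.
- by rewrite invr_ge0 sqr_ge0.
- by rewrite ler_wpM2l ?(ltW M0)// ler_pXn2r// nnegrE// (le_trans mu0).
by rewrite lef_pV2 ?posrE ?exprn_gt0// ler_pXn2r ?nnegrE ?(ltW k0) ?(ltW l0)// lerD2l lerN2.
Qed.
End ScalarComparison.

(** * The coarse Newton step *)

Section InnerProduct.
Context {R : realType} {n : nat} {A : 'M[R]_n}.
Hypothesis A_pd : posdefmx A.

Let form (u v : 'cV[R]_n) : R := (u^T *m A *m v) 0 0.

Lemma posdef_form_sym u v : form u v = form v u.
Proof.
rewrite /form -[in LHS](trmxK (u^T *m A *m v)) [LHS]mxE !trmx_mul trmxK.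
by case: A_pd => -> _; rewrite mulmxA.
Qed.

Lemma posdef_form_linear a u v w : form (a *: u + v) w = a * form u w + form v w.
Proof. by rewrite /form linearP/= !mulmxDl -!scalemxAl !mxE. Qed.

Lemma posdef_ge0 u : 0 <= quad_form A u.
Proof.
have [->|u0] := eqVneq u 0; last by case: A_pd => _ /(_ u u0)/ltW.
by rewrite /quad_form mulmx0 mxE.
Qed.

Lemma posdef_unitmx : A \in unitmx.
Proof.
rewrite -row_free_unit; apply: inj_row_free => v vA; apply/eqP.
have [//|v0] := eqVneq v 0; case: A_pd => _ /(_ v^T).
by rewrite trmx_eq0 v0 /quad_form trmxK vA mul0mx mxE ltxx => /(_ isT).
Qed.

Lemma quad_form_invmx g : quad_form (invmx A) g = quad_form A (invmx A *m g).
Proof.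
rewrite /quad_form trmx_mul trmx_inv; case: (A_pd) => -> _.
by rewrite mulmxA mulmxKV ?posdef_unitmx.
Qed.

Lemma posdef_cauchy_schwarz u v : form u v <= Num.sqrt (quad_form A u) * Num.sqrt (quad_form A v).
Proof.
have [->|u0] := eqVneq u 0.
  by rewrite /form trmx0 !mul0mx mxE mulr_ge0 ?sqrtr_ge0.
have uu : 0 < form u u by case: A_pd => _; exact.
rewrite -sqrtrM ?posdef_ge0// (le_trans (ler_norm _))// -sqrtr_sqr ler_wsqrtr//.
(* This is the component of [v] orthogonal to [u]; its squared length is (a c - b^2) / a in the
   notation below. *)
have := posdef_ge0 (- form u v / form u u *: u + v).
rewrite /quad_form -/(form _ _) posdef_form_linear !(posdef_form_sym _ (_ + _)).
rewrite !posdef_form_linear (posdef_form_sym v u) -/(form u u) -/(form v v).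
set a := form u u; set b := form u v; set c := form v v => h.
have {h} : 0 <= (a * c - b ^+ 2) / a.
  by rewrite (le_trans h)// le_eqVlt; apply/orP; left; apply/eqP; field; rewrite gt_eqF.
by rewrite pmulr_lge0 ?invr_gt0// subr_ge0.
Qed.
End InnerProduct.

(** Full row rank makes the prolongation [r^T] injective, so a nonzero z has a nonzero image. *)
Lemma posdef_congr (R : realType) (n p : nat) (A : 'M[R]_n) (r : 'M[R]_(p, n)) :
  posdefmx A -> row_free r -> posdefmx (r *m A *m r^T).
Proof.
move=> [A_sym A_pos] r_free; split; first by rewrite !trmx_mul trmxK A_sym mulmxA.
move=> z z0; have := A_pos (r^T *m z); rewrite /quad_form trmx_mul trmxK !mulmxA; apply.
apply: contraNneq z0 => rz; rewrite -trmx_eq0; apply/eqP.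
apply: (row_free_inj r_free); rewrite mul0mx.
by rewrite -[_ *m r]trmxK trmx_mul trmxK rz trmx0.
Qed.

Lemma quad_formN (R : realType) (n : nat) (A : 'M[R]_n) u : quad_form A (- u) = quad_form A u.
Proof. by rewrite /quad_form [(- u)^T]linearN/= !mulNmx mulmxN opprK. Qed.

(** * Self-concordance in the local norms *)

Section SelfConcordant.
Context {R : realType} {n : nat} {f : 'cV[R]_n -> R} {M : R}.
Hypothesis M_gt0 : 0 < M.
Hypothesis f_sc : self_concordant M f.
Hypothesis hess_pd : forall y, posdefmx (hessian f y).

Local Notation norm x u := (Num.sqrt (quad_form (hessian f x) u)).

Lemma third_derivative_linear x a u v w z :
  third_derivative f x (a *: u + v) w z =
    a * third_derivative f x u w z + third_derivative f x v w z.
Proof.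
rewrite /third_derivative mulr_sumr -big_split; apply: eq_bigr => i _ /=.
rewrite mulr_sumr -big_split; apply: eq_bigr => j _ /=.
by rewrite mulr_sumr -big_split; apply: eq_bigr => l _ /=; rewrite !mxE; ring.
Qed.

(** The real exponent 3/2 becomes the cube of a norm, the form that [polarization] takes. *)
Lemma self_concordant_norm x u : `|third_derivative f x u u u| <= 2 * M * norm x u ^+ 3.
Proof.
have := f_sc.2 x u; have := posdef_ge0 (hess_pd x) u.
move: (quad_form _ _) => q q0; congr (_ <= _ * _).
by rewrite mulrC powRrM powR12_sqrt// powR_mulrn// sqrtr_ge0.
Qed.

Lemma self_concordant_polarized x u w :
  `|third_derivative f x w u u| <= 2 * M * norm x w * quad_form (hessian f x) u.
Proof.
have f3 := f_sc.1; have Hs y := (hess_pd y).1.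
apply: (polarization (fun u v => (u^T *m hessian f x *m v) 0 0) (third_derivative f x)).
- exact: posdef_form_sym.
- exact: posdef_form_linear.
- by move=> v v0; apply: (hess_pd x).2.
- exact: third_derivative_syml.
- exact: third_derivative_symr.
- exact: third_derivative_linear.
- by rewrite mulr_ge0// ltW.
- exact: self_concordant_norm.
Qed.

Lemma self_concordant_step (x h w : 'cV[R]_n) : M * norm x h < 1 ->
  quad_form (hessian f x) w * (1 - M * norm x h) ^+ 2 <= quad_form (hessian f (x + h)) w /\
  (w^T *m gradient f (x + h)) 0 0 - (w^T *m gradient f x) 0 0 - (h^T *m hessian f x *m w) 0 0
    <= norm x w * M * norm x h ^+ 2 / (1 - M * norm x h).
Proof.
have f3 := f_sc.1; have Hs y := (hess_pd y).1.
have dq u (t : R) : is_derive t 1 (fun s => quad_form (hessian f (x + s *: h)) u)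
    (third_derivative f (x + t *: h) h u u).
  exact: (is_derive_hessian_line f3 x h u u t).
have := self_concordant_segment M (fun t => quad_form (hessian f (x + t *: h)) h) _
  (fun t => quad_form (hessian f (x + t *: h)) w) _ _ _ _ M_gt0 _ _ _
  (dq h) (dq w) (is_derive_gradient_line f3 x h w) (is_derive_hessian_line f3 x h h w).
rewrite scale0r addr0 scale1r => seg k1; apply: seg => //.
- have [->|h0] := eqVneq h 0; first by right => t; rewrite /quad_form mulmx0 mxE.
  by left => t; apply: (hess_pd _).2.
- by move=> t; apply: posdef_ge0.
- by move=> t; apply: self_concordant_norm.
- by move=> t; apply: self_concordant_polarized.
(* The second derivative of w^T grad f is D^3 f[h,h,w]; symmetry moves [w] to the front. *)
move=> t; rewrite (third_derivative_symr Hs) (third_derivative_syml f3).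
exact: self_concordant_polarized.
Qed.

(** * The step of a full-rank restriction operator *)

Section CoarseStep.
Variables (p : nat) (r : 'M[R]_(p, n)).
Hypothesis r_free : row_free r.

Let coarse_pd y : posdefmx (coarse_hessian f r y).
Proof. exact: posdef_congr. Qed.

Definition coarse_step (x : 'cV[R]_n) : 'cV[R]_n :=
  - (r^T *m (invmx (coarse_hessian f r x) *m (r *m gradient f x))).

Lemma trial_pointE x : trial_point f r x = x + coarse_step x.
Proof. by rewrite /trial_point -mulmxA. Qed.

Lemma coarse_newton_equation x : r *m (hessian f x *m coarse_step x) = - (r *m gradient f x).
Proof.
rewrite /coarse_step !mulmxN; congr (- _).
by rewrite !mulmxA -/(coarse_hessian f r x) mulmxV ?posdef_unitmx// mul1mx.
Qed.

(** The coarse step is the orthogonal projection of the Newton step in the local inner product.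
    Concretely, mu^2 = - h^T grad f is the inner product of - h with H^(-1) grad f, so
    Cauchy-Schwarz gives mu^2 <= mu lambda. *)
Lemma coarse_step_norm x : norm x (coarse_step x) <= newton_decrement f x.
Proof.
have newton := coarse_newton_equation x.
pose c := invmx (coarse_hessian f r x) *m (r *m gradient f x).
have hE : coarse_step x = - (r^T *m c) by [].
move: (coarse_step x) hE newton => h hE newton; pose mu := norm x h.
have mu2 : mu ^+ 2 = ((- h)^T *m gradient f x) 0 0.
  have hT : h^T = - (c^T *m r) by rewrite hE linearN/= trmx_mul trmxK.
  rewrite sqr_sqrtr ?posdef_ge0// /quad_form [(- h)^T]linearN/= hT opprK !mulNmx.
  by rewrite -!mulmxA newton mulmxN opprK.
have CS : ((- h)^T *m gradient f x) 0 0 <= mu * newton_decrement f x.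
  have -> : (- h)^T *m gradient f x =
      (- h)^T *m hessian f x *m (invmx (hessian f x) *m gradient f x).
    by rewrite -!mulmxA mulKVmx ?posdef_unitmx.
  apply: (le_trans (posdef_cauchy_schwarz (hess_pd x) _ _)).
  by rewrite -quad_form_invmx// quad_formN.
have [mu0|mu0] := eqVneq mu 0; first by rewrite -/mu mu0 sqrtr_ge0.
by rewrite -(@ler_pM2l _ mu) ?lt0r ?mu0 ?sqrtr_ge0// -expr2 mu2.
Qed.

(** The witness solves the coarse Newton system at [y], so both right-hand sides equal z^T A z for
    the coarse Hessian A at [y]. *)
Lemma coarse_decrement_dual y : exists z : 'cV[R]_p,
  coarse_decrement f r y ^+ 2 = quad_form (hessian f y) (r^T *m z) /\
  coarse_decrement f r y ^+ 2 = ((r^T *m z)^T *m gradient f y) 0 0.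
Proof.
have [z Az] : exists z, coarse_hessian f r y *m z = r *m gradient f y.
  by exists (invmx (coarse_hessian f r y) *m (r *m gradient f y)); rewrite mulKVmx ?posdef_unitmx.
have E : coarse_decrement f r y ^+ 2 = quad_form (coarse_hessian f r y) z.
  by rewrite sqr_sqrtr quad_form_invmx ?posdef_ge0// -Az mulKmx ?posdef_unitmx.
exists z; split; rewrite E /quad_form trmx_mul trmxK; first by rewrite /coarse_hessian !mulmxA.
by rewrite -[z^T *m _ *m z]mulmxA Az mulmxA.
Qed.

Lemma coarse_decrement_trial x : M * newton_decrement f x < 1 ->
  coarse_decrement f r (trial_point f r x) <=
    M * newton_decrement f x ^+ 2 / (1 - M * newton_decrement f x) ^+ 2.
Proof.
move=> Ml1; rewrite trial_pointE.
have mul := coarse_step_norm x; have newton := coarse_newton_equation x.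
move: (coarse_step x) mul newton => h mul newton.
have [z [g_quad g_grad]] := coarse_decrement_dual (x + h).
(* The direction r^T z lies in the coarse space, so the coarse Newton equation at [x], tested
   against [z], cancels the linear part. *)
have stationary : ((r^T *m z)^T *m gradient f x) 0 0 + (h^T *m hessian f x *m (r^T *m z)) 0 0 = 0.
  rewrite (posdef_form_sym (hess_pd x)) trmx_mul trmxK -!mulmxA newton.
  by rewrite mulmxN [X in _ + X]mxE subrr.
have Mmu1 : M * norm x h < 1 by apply: le_lt_trans Ml1; rewrite ler_wpM2l// ltW.
have [low rem] := self_concordant_step x h (r^T *m z) Mmu1.
apply: (decrement_bound M (norm x h) _ _ (norm x (r^T *m z))) => //.
- by rewrite sqrtr_ge0.
- exact: sqrtr_ge0.
- by rewrite g_quad [norm x (r^T *m z) ^+ 2]sqr_sqrtr ?posdef_ge0.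
by apply: le_trans rem; rewrite g_grad -addrA -opprD stationary subr0.
Qed.
End CoarseStep.
End SelfConcordant.

Theorem theorem4p7 (R : realType) (m : nat) (d : nat -> nat)
  (r : forall i k : nat, 'M[R]_(d i, d m))
  (f : 'cV[R]_(d m) -> R) (M sigma : R) (x : nat -> 'cV[R]_(d m))
  (hd : level_dimensions m d)
  (hr : restriction_operators r)
  (hM : 0 < M)
  (hconv : strictly_convex f)
  (hsc : self_concordant M f)
  (hbelow : bounded_below f)
  (hhess : forall y, posdefmx (hessian f y))
  (hsigma : 0 < sigma <= 1)
  (hx : adaptive_multilevel_newton r f sigma x) :
  forall k : nat, M * newton_decrement f (x k) < 1 ->
    newton_decrement f (x k.+1)
      <= M * newton_decrement f (x k) ^+ 2
           / (sigma * (1 - M * newton_decrement f (x k)) ^+ 2).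
Proof.
move=> k Ml1; have [i [/andP[i1 im] /andP[_ acc] _ xk]] := hx k.
have [sigma_gt0 _] := andP hsigma.
have r_free : row_free (r i k).
  (* The rank condition covers the coarse levels; at the fine level the operator is the identity. *)
  move: im; rewrite leq_eqVlt => /orP[/eqP ->|im].
    by rewrite hr.2 row_free_unit unitmx1.
  by rewrite /row_free hr.1// i1.
have := coarse_decrement_trial hM hsc hhess _ (r i k) r_free (x k) Ml1.
rewrite -xk in acc *; move=> /(le_trans acc).
rewrite mulrC -ler_pdivlMr// => /le_trans; apply.
by rewrite [(sigma * _)^-1]invfM [sigma^-1 * _]mulrC [leRHS]mulrA.
Qed.
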